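(* Let $\Omega$, $F$, $K$ be as in the context. Suppose that $F$ only takes polyhedral values and that $\max_{x\in\Omega}|\operatorname{ext}(F(x))|<+\infty$. Then $(\mathcal{SP})$ satisfies (wFDVP).
   Context: $\mathbb{N}=\{1,2,\ldots\}$ and $[p]=\{1,\ldots,p\}$; $|A|$ denotes cardinality; $\operatorname{ext}(A)$ denotes the set of extreme points of a convex set $A\subseteq\mathbb{R}^m$; polyhedral means being a (convex) polyhedron. Setting: $\Omega\subseteq\mathbb{R}^n$ is nonempty and closed; $F:\mathbb{R}^n\rightrightarrows\mathbb{R}^m$ is a set-valued mapping with $\Omega\subseteq \operatorname{dom}F:=\{x: F(x)\neq\emptyset\}$ and $F(x)$ compact for every $x\in\Omega$; $K\subseteq\mathbb{R}^m$ is a closed, convex, pointed ($K\cap(-K)=\{0\}$), solid ($\operatorname{int}K\ne\emptyset$) cone. Set optimization problem $(\mathcal{SP})$: minimize $F(x)$ over $x\in\Omega$ with respect to the lower set less relation. A point $\bar x\in\Omega$ is a weakly minimal solution of $(\mathcal{SP})$, written $\bar x\in\operatorname{wargmin}(\mathcal{SP})$, if there is no $x\in\Omega$ with $F(\bar x)\subseteq F(x)+\operatorname{int}K$. Multiobjective problem $(\mathcal{VP}_p)$, $p\in\mathbb{N}$: minimize $(y^1,\ldots,y^p)\in\mathbb{R}^{mp}$ with respect to the cone $K^p=\prod_{i=1}^pK$ over all feasible $(x,y^1,\ldots,y^p)$, i.e. $x\in\Omega$ and $y^i\in F(x)$ for all $i\in[p]$. A feasible $(\bar x,\bar y^1,\ldots,\bar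 y^p)$ is a weakly minimal solution if there is no feasible $(x,y^1,\ldots,y^p)$ with $\bar y^i-y^i\in\operatorname{int}K$ for all $i\in[p]$. The set $\operatorname{wargmin}_x(\mathcal{VP}_p)$ is the projection onto the $x$-component in $\mathbb{R}^n$ of the set of weakly minimal solutions of $(\mathcal{VP}_p)$. $(\mathcal{SP})$ satisfies the weakly minimal finite dimensional vectorization property (wFDVP) if there exists $p\in\mathbb{N}$ with $\operatorname{wargmin}_x(\mathcal{VP}_p)=\operatorname{wargmin}(\mathcal{SP})$. *)

(* Defs.v *)
From mathcomp Require Import all_boot all_order all_algebra.
From mathcomp Require Import all_classical all_reals all_analysis.

Set Implicit Arguments.
Unset Strict Implicit.
Unset Printing Implicit Defensive.

Import Order.TTheory GRing.Theory Num.Theory.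
Import numFieldNormedType.Exports.

Local Open Scope classical_set_scope.
Local Open Scope ring_scope.

Section ConvexGeometry.
Context {R : realType} {m : nat}.
Implicit Types A K : set 'rV[R]_m.

Definition is_cone K := forall (t : R) v, 0 <= t -> K v -> K (t *: v).

Definition is_pointed K := K `&` [set - k | k in K] = [set 0].

Definition is_solid K := K° !=set0.

(* Finite intersections of closed half-spaces: the whole space is the case
   k = 0, and the empty set is a polyhedron. *)
Definition polyhedral A :=
  exists (k : nat) (M : 'M[R]_(k, m)) (b : 'cV[R]_k),
    A = [set y | forall i, (M *m y^T) i 0 <= b i 0].

Definition ext A : set 'rV[R]_m :=
  [set a | A a /\ forall u v (t : R), A u -> A v -> 0 < t < 1 ->
                    a = t *: u + (1 - t) *: v -> u = a /\ v = a].

Definition set_add A K : set 'rV[R]_m := [set a + k | a in A & k in K].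

End ConvexGeometry.

Section Problems.
Context {R : realType} {n m : nat}.
Implicit Types (Omega : set 'rV[R]_n) (F : 'rV[R]_n -> set 'rV[R]_m)
  (K : set 'rV[R]_m).

Definition dom F : set 'rV[R]_n := [set x | F x !=set0].

Definition wargmin_SP Omega F K : set 'rV[R]_n :=
  [set xb | Omega xb /\
            ~ exists2 x, Omega x & F xb `<=` set_add (F x) K°].

Definition feasible_VP (p : nat) Omega F :
    set ('rV[R]_n * ('I_p -> 'rV[R]_m)) :=
  [set z | Omega z.1 /\ forall i, F z.1 (z.2 i)].

Definition wmin_VP (p : nat) Omega F K :
    set ('rV[R]_n * ('I_p -> 'rV[R]_m)) :=
  [set zb | feasible_VP Omega F zb /\
            ~ exists2 z, feasible_VP Omega F z &
                         forall i, K° (zb.2 i - z.2 i)].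

Definition wargmin_x (p : nat) Omega F K : set 'rV[R]_n :=
  fst @` @wmin_VP p Omega F K.

Definition wFDVP Omega F K :=
  exists p : nat, (0 < p)%N /\ wargmin_x p Omega F K = wargmin_SP Omega F K.

End Problems.

(* Main.v *)
(* For any p, a point x dominating xb for the set problem gives y^i in F(x)
   dominating the yb^i, so the projection of the weakly minimal solutions of
   (VP_p) lies in wargmin(SP). Conversely, take p > N and let the yb^i run
   through ext(F(xb)), with repetitions. If (x, y^1, ..., y^p) dominates them,
   the convex set F(x) + int K contains ext(F(xb)), hence its convex hull, which
   is F(xb) because F(xb) is a polytope. *)
Require Import Defs.
From mathcomp Require Import all_boot all_order all_algebra.
From mathcomp Require Import all_classical all_reals all_analysis.
From mathcomp Require Import ring lra.

Import Order.TTheory GRing.Theory Num.Theory.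
Import numFieldNormedType.Exports.

Local Open Scope classical_set_scope.
Local Open Scope card_scope.
Local Open Scope ring_scope.

Lemma convex_setP (R : realType) (V : lmodType R) (A : set V) : convex_set A <->
  forall u v (t : R), A u -> A v -> 0 < t < 1 -> A (t *: u + (1 - t) *: v).
Proof.
split=> [cA u v t Au Av t01|cA].
  have [t0 t1] := andP t01.
  have := cA u v (Itv01 (ltW t0) (ltW t1)).
  by rewrite !inE => /(_ Au Av).
apply/convex_setW => u v; rewrite !inE => Au Av k k0 k1.
by rewrite inE; apply: cA => //; rewrite k0.
Qed.

(** Each endpoint is weighted by the step length towards the other one, so the two displacements
    along [d] cancel. *)
Lemma between_prolongations (R : realType) (V : lmodType R) (a d : V)
    (s s' : R) : s + s' != 0 ->
  a = (s' / (s + s')) *: (a + s *: d) + (1 - s' / (s + s')) *: (a + s' *: - d).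
Proof.
move=> ss'; have -> : 1 - s' / (s + s') = s / (s + s') by field.
rewrite !scalerDr scalerN scalerN !scalerA addrACA -scalerDl -mulrDl.
rewrite [s' + s]addrC mulfV// scale1r mulrAC [X in _ - X *: _]mulrAC.
by rewrite [s' * s]mulrC subrr addr0.
Qed.

Lemma interior_convex (R : realType) (V : normedModType R) (K : set V) :
  convex_set K -> convex_set K°.
Proof.
move=> /convex_setP cK; apply/convex_setP => u v t Ku Kv t01.
have /andP[t0 t1] := t01.
set w := _ + _.
(* Keep [v] fixed and solve [z = t *: u' + (1 - t) *: v] for [u']: as [z] tends to [w], [u'] tends
   to [u], so it is eventually in [K]. *)
have cvg_u : u + t^-1 *: (z - w) @[z --> w] --> u.
  rewrite -[X in _ --> X](_ : u + t^-1 *: (w - w) = _); last first.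
    by rewrite subrr scaler0 addr0.
  apply: cvgD; first exact: cvg_cst.
  by apply: cvgZl_tmp; apply: cvgB; [exact: cvg_id|exact: cvg_cst].
have : \forall z \near w, K (u + t^-1 *: (z - w)) by exact: cvg_u Ku.
apply: filterS => z Kz.
have -> : z = t *: (u + t^-1 *: (z - w)) + (1 - t) *: v.
  by rewrite scalerDr scalerA mulfV ?gt_eqF// scale1r addrAC addrC subrK.
by apply: cK => //; exact: interior_subset.
Qed.

Lemma set_add_convex (R : realType) (m : nat) (A B : set 'rV[R]_m) :
  convex_set A -> convex_set B -> convex_set (set_add A B).
Proof.
move=> /convex_setP cA /convex_setP cB; apply/convex_setP.
move=> _ _ t [a Aa [b Bb <-]] [c Ac [d Bd <-]] t01.
exists (t *: a + (1 - t) *: c); first exact: cA.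
exists (t *: b + (1 - t) *: d); first exact: cB.
by rewrite !scalerDr addrACA.
Qed.

Section Polyhedra.
Context {R : realType} {m k : nat} (M : 'M[R]_(k, m)) (b : 'cV[R]_k).
Local Notation f y i := ((M *m y^T) i 0).
Local Notation P := [set y : 'rV[R]_m | forall i, f y i <= b i 0].
Implicit Types (a d u v : 'rV[R]_m).

Lemma constraintD u v i : f (u + v) i = f u i + f v i.
Proof. by rewrite linearD mulmxDr mxE. Qed.

Lemma constraintZ (t : R) u i : f (t *: u) i = t * f u i.
Proof. by rewrite linearZ -scalemxAr mxE. Qed.

Lemma constraintN u i : f (- u) i = - f u i.
Proof. by rewrite -[in LHS]scaleN1r constraintZ mulN1r. Qed.

Lemma polyhedron_convex : convex_set P.
Proof.
apply/convex_setP => u v t Pu Pv /andP[t0 t1] i /=.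
rewrite constraintD !constraintZ.
by move: (Pu i) (Pv i) => /=; nra.
Qed.

Lemma bounded_ray a d :
  bounded_set P -> d != 0 -> exists2 s, 0 <= s & ~ P (a + s *: d).
Proof.
move=> [B [_ PB]] d0.
have nd : 0 < `|d| by rewrite normr_gt0.
(* Boundedness only provides bounds strictly above [B]; [B'] is one of them and is nonnegative. *)
pose B' := `|B| + 1.
have PB' y : P y -> `|y| <= B'.
  by apply: PB; rewrite (le_lt_trans (ler_norm B))// ltrDl.
(* This step has length [|a| + B' + 1], so it ends at norm at least [B' + 1]. *)
exists ((`|a| + B' + 1) / `|d|); first by rewrite divr_ge0// !addr_ge0.
move=> /PB'; apply/negP; rewrite -ltNge.
have := ler_normB (a + ((`|a| + B' + 1) / `|d|) *: d) a.
rewrite addrC addKr normrZ ger0_norm ?divr_ge0 ?addr_ge0//.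
rewrite divfK ?gt_eqF//; lra.
Qed.

(** Ratio test: among the constraints that increase along [d], the one with the least ratio of slack
    to rate is met first. The ray leaves [P], and a constraint violated on it must increase, so
    there is a candidate. *)
Lemma hit_facet a d : bounded_set P -> P a -> d != 0 ->
  exists s i, [/\ 0 <= s, P (a + s *: d), 0 < f d i
                & f (a + s *: d) i = b i 0].
Proof.
move=> Pb Pa d0; have [r r0] := bounded_ray a d Pb d0.
move=> /existsNP[j /negP]; rewrite -ltNge constraintD constraintZ => bj.
have fj : 0 < f d j.
  rewrite ltNge; apply/negP => fj.
  have := Pa j; have := mulr_ge0_le0 r0 fj; lra.
case: (@arg_minP _ _ _ j (fun i => 0 < f d i)
  (fun i => (b i 0 - f a i) / f d i)) => // i fi imin.
have s0 : 0 <= (b i 0 - f a i) / f d i.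
  by apply: divr_ge0; [rewrite subr_ge0; exact: Pa|exact: ltW].
exists ((b i 0 - f a i) / f d i), i; split=> //.
- move=> l; rewrite constraintD constraintZ.
  have [fl|fl] := ltP 0 (f d l).
    by rewrite addrC -lerBrDr -ler_pdivlMr// imin.
  by have := Pa l; have := mulr_ge0_le0 s0 fl; lra.
- by rewrite constraintD constraintZ divfK ?gt_eqF// addrC subrK.
Qed.

(* A point that is not extreme lies inside a segment of P, on which its active
   constraints stay active. Prolonged in both directions until it leaves P, the
   segment has endpoints with more active constraints. *)
Lemma polytope_sub_convex (C : set 'rV[R]_m) :
  bounded_set P -> convex_set C -> ext P `<=` C -> P `<=` C.
Proof.
move=> Pb /convex_setP cC extC a.
(* Strong induction on the number of inactive constraints at [a]. *)
have [c] := ubnP #|[pred i | f a i != b i 0]|.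
elim: c a => // c IH a; rewrite ltnS => ac Pa.
have [/extC//|nea] := pselect (ext P a).
have [u [v [t [Pu Pv /andP[t0 t1] aE uv]]]] : exists u v (t : R),
    [/\ P u, P v, 0 < t < 1, a = t *: u + (1 - t) *: v & u != v].
  apply: contrapT => h; apply: nea; split=> // u v t Pu Pv t01 aE.
  have [uv|uv] := eqVneq u v; last by case: h; exists u, v, t.
  by rewrite aE uv -scalerDl addrC subrK scale1r.
(* A proper average of two values at most [b i 0] equals [b i 0] only if both do. *)
have active0 i : f a i = b i 0 -> f (u - v) i = 0.
  rewrite aE !constraintD !constraintZ constraintN.
  by move: (Pu i) (Pv i) => /=; nra.
have prolong d : d != 0 -> (forall i, f a i = b i 0 -> f d i = 0) ->
    exists2 s, 0 < s & C (a + s *: d).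
  move=> d0 ad0; have [s [i [s0 Ps di ib]]] := hit_facet a d Pb Pa d0.
  have nai : f a i != b i 0.
    by apply/eqP => /ad0 e; move: di; rewrite e ltxx.
  exists s.
    (* If [s] were zero, the constraint [i] would already be active at [a]. *)
    rewrite lt_neqAle s0 andbT eq_sym; apply: contraNneq nai => s00.
    by rewrite -ib s00 scale0r addr0.
  apply: IH Ps; apply: leq_trans ac; apply: proper_card; apply/properP; split.
    apply/fintype.subsetP => l; rewrite !inE; apply: contraNneq => al.
    by rewrite constraintD constraintZ (ad0 l al) mulr0 addr0 al.
  by exists i; rewrite !inE ?ib ?eqxx.
have uv0 : u - v != 0 by rewrite subr_eq0.
have [s s0 Cs] := prolong _ uv0 active0.
have [||s' s'0 Cs'] := prolong (- (u - v)).
- by rewrite oppr_eq0.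
- by move=> i /active0 e; rewrite constraintN e oppr0.
have ss' : s + s' != 0 by rewrite gt_eqF// addr_gt0.
rewrite (between_prolongations _ _ a (u - v) _ _ ss').
apply: cC => //.
by rewrite divr_gt0 ?addr_gt0//= ltr_pdivrMr ?addr_gt0// mul1r ltrDr.
Qed.

End Polyhedra.

Lemma finite_enum (T : pointedType) (A : set T) (N : nat) :
  A !=set0 -> A #<= `I_N ->
  exists y : 'I_N.+1 -> T,
    (forall i, A (y i)) /\ (forall a, A a -> exists i, y i = a).
Proof.
move=> [y0 Ay0] /pcard_surjP[g gsurj].
(* [g] covers [A] but may also take values outside it; these are replaced by [y0]. *)
exists (fun i => if g i \in A then g i else y0); split.
  by move=> i; case: ifPn => // /set_mem.
move=> a Aa; have [l lN gl] := gsurj a Aa.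
have lN1 : (l < N.+1)%N by exact: ltnW.
by exists (Ordinal lN1); rewrite /= gl mem_set.
Qed.

Theorem theorem4p7 (R : realType) (n m : nat)
    (Omega : set 'rV[R]_n) (F : 'rV[R]_n -> set 'rV[R]_m) (K : set 'rV[R]_m)
    (Omega_neq0 : Omega !=set0)
    (Omega_closed : closed Omega)
    (Omega_dom : Omega `<=` dom F)
    (F_compact : forall x, Omega x -> compact (F x))
    (K_closed : closed K)
    (K_convex : convex_set K)
    (K_cone : is_cone K)
    (K_pointed : is_pointed K)
    (K_solid : is_solid K)
    (F_polyhedral : forall x, Omega x -> polyhedral (F x))
    (F_ext_bounded : exists N : nat, forall x, Omega x -> ext (F x) #<= `I_N) :
  wFDVP Omega F K.
Proof.
have {F_ext_bounded}[N extN] := F_ext_bounded.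
(* Minkowski's theorem with any convex [C] in place of the convex hull; it serves below for the
   empty set and for [F x'] plus the interior of [K]. *)
have minkowski x (C : set 'rV[R]_m) : Omega x -> convex_set C ->
    ext (F x) `<=` C -> F x `<=` C.
  move=> Ox cC; have := compact_bounded (F_compact x Ox).
  by have [k [M [b ->]]] := F_polyhedral x Ox => Fb; exact: polytope_sub_convex.
exists N.+1; split=> //; apply/seteqP; split.
- move=> _ [[x y] [[/= Ox Fy] xmin] <-]; split=> //= -[x' Ox' FF'].
  have /choice[y' Fy'] : forall i, exists y', F x' y' /\ K° (y i - y').
    move=> i; have [y' Fy' [k Kk yk]] := FF' _ (Fy i).
    by exists y'; rewrite -yk addrC addKr.
  apply: xmin; exists (x', y'); first by split=> // i; case: (Fy' i).
  by move=> i; case: (Fy' i).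
- move=> x [Ox xmin].
  (* Without extreme points, [F x] would lie in the empty set, which is convex. *)
  have ext0 : ext (F x) !=set0.
    apply: contrapT => /nonemptyPn e0.
    have [y Fy] := Omega_dom x Ox.
    suff : F x `<=` set0 by move=> /(_ y Fy).
    by apply: minkowski => //; rewrite e0.
  have [y [exty ysurj]] := finite_enum _ _ _ ext0 (extN x Ox).
  exists (x, y) => //; split=> [|[[x' y'] [/= Ox' Fy'] Ky]].
    by split=> //= i; case: (exty i).
  apply: xmin; exists x' => //; apply: minkowski => //.
    apply: set_add_convex; last exact: interior_convex.
    by have [k [M [b ->]]] := F_polyhedral x' Ox'; exact: polyhedron_convex.
  move=> _ /ysurj[i <-]; exists (y' i); first exact: Fy'.
  by exists (y i - y' i); [exact: Ky|rewrite addrC subrK].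
Qed.
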